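(* Let $P=[-1,1]^d$ and let $\sigma_1,\sigma_2\in\{+,-\}$. For $1\le i\neq j\le d$, $$\mathcal{B}_{i^{\sigma_1},\,j^{\sigma_2}}=\sigma_1\mathcal{H}_i\cap(-\sigma_2\mathcal{H}_j).$$ For $i=j$, $$\mathcal{B}_{i^{\sigma_1},\,i^{\sigma_2}}=\begin{cases}\{a\in\mathbb{R}^d: a_i=0\} & \text{if }\sigma_1=\sigma_2,\\ C_{F_i^{\sigma_1}} & \text{if }\sigma_1\neq\sigma_2.\end{cases}$$
   Context: For $P=[-1,1]^d$ the distance function is $\operatorname{dist}(a,b)=\|b-a\|_\infty$. The bisector is $\operatorname{bis}(a,b)=\{x\in\mathbb{R}^d:\|x-a\|_\infty=\|x-b\|_\infty\}$. The facets of $P$ are $F_i^{+}=\{x\in P:x_i=1\}$ and $F_i^{-}=\{x\in P:x_i=-1\}$, $i=1,\dots,d$. For a facet $F$, $C_F=\operatorname{cone}(F)$ is the set of all finite nonnegative linear combinations of points of $F$. For facets $F,G$, $\operatorname{bis}_{F,G}(a,b)=\operatorname{bis}(a,b)\cap(C_F+a)\cap(C_G+b)$ and the bisection cone is $\mathcal{B}_{F,G}=\{x\in\mathbb{R}^d:\operatorname{bis}_{F,G}(0,x)\neq\emptyset\}$. Write $\mathcal{B}_{i^{\sigma_1},\,j^{\sigma_2}}=\mathcal{B}_{F_i^{\sigma_1},F_j^{\sigma_2}}$ and $\mathcal{H}_i=\{x\in\mathbb{R}^d:x_i\ge 0\}$; signs $\pm$ are identified with $\pm1$, so $+\mathcal{H}_i=\mathcal{H}_i$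 and $-\mathcal{H}_i=\{x: x_i\le 0\}$. *)

(* Defs.v *)
From mathcomp Require Import all_boot all_order all_algebra.
From mathcomp Require Import all_classical all_reals all_analysis.

Import Order.TTheory GRing.Theory Num.Theory.
Import numFieldNormedType.Exports.

Local Open Scope classical_set_scope.
Local Open Scope ring_scope.

(* R^d is 'rV[R]_d; its library norm `|x| is the maximum norm
   max_i |x 0 i| (mx_normrE). *)

(* A sign is a boolean: false is +, true is -. *)
Definition sgn {R : realType} (s : bool) : R := (-1) ^+ s.

Definition cube {R : realType} {d : nat} : set 'rV[R]_d :=
  [set x | forall k, -1 <= x 0 k <= 1].

Definition facet {R : realType} {d : nat} (s : bool) (i : 'I_d) :
    set 'rV[R]_d :=
  [set x | cube x /\ x 0 i = sgn s].

Definition halfspace {R : realType} {d : nat} (i : 'I_d) : set 'rV[R]_d :=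
  [set x | 0 <= x 0 i].

Definition cone {R : realType} {d : nat} (A : set 'rV[R]_d) :
    set 'rV[R]_d :=
  [set x | exists (n : nat) (c : 'I_n -> R) (p : 'I_n -> 'rV[R]_d),
    [/\ forall k, 0 <= c k, forall k, A (p k) & x = \sum_(k < n) c k *: p k]].

Definition translate {R : realType} {d : nat} (A : set 'rV[R]_d)
    (a : 'rV[R]_d) : set 'rV[R]_d :=
  [set x + a | x in A].

Definition dilate {R : realType} {d : nat} (c : R) (A : set 'rV[R]_d) :
    set 'rV[R]_d :=
  [set c *: x | x in A].

Definition bis {R : realType} {d : nat} (a b : 'rV[R]_d) : set 'rV[R]_d :=
  [set x | `|x - a| = `|x - b| :> R].

Definition bis_facets {R : realType} {d : nat} (F G : set 'rV[R]_d)
    (a b : 'rV[R]_d) : set 'rV[R]_d :=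
  bis a b `&` translate (cone F) a `&` translate (cone G) b.

Definition bisection_cone {R : realType} {d : nat} (F G : set 'rV[R]_d) :
    set 'rV[R]_d :=
  [set x | bis_facets F G 0 x !=set0].

(* Main.v *)
(* A point x lies in the cone over the facet F_i^s exactly when s * x_i = |x|.
   Hence x is in the bisection cone of F_i^s1, F_j^s2 iff there are r and y with
   all |y_k| <= r, all |y_k - x_k| <= r, s1 * y_i = r and s2 * (y_j - x_j) = r.
   The sign conditions on x follow at once; conversely, take for y the point x
   with y_i moved to s1 * |x| and (when i <> j) y_j moved to x_j + s2 * |x|,
   or y = x / 2 for two opposite facets. *)
Require Import Defs.
From mathcomp Require Import all_boot all_order all_algebra.
From mathcomp Require Import all_classical all_reals all_analysis.
From mathcomp Require Import lra.

Import Order.TTheory GRing.Theory Num.Theory.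
Import numFieldNormedType.Exports.

Local Open Scope classical_set_scope.
Local Open Scope ring_scope.

(** The hypothesis [0 <= r] matters for [d = 0], where the coordinate bounds are vacuous and the
    norm is 0. *)
Lemma rV_normP (R : realType) (d : nat) (x : 'rV[R]_d) (r : R) : 0 <= r ->
  `|x| <= r <-> forall k, `|x 0 k| <= r.
Proof.
move=> r0; rewrite [`|x|]mx_normrE; split=> [/bigmax_leP[_ xr] k|xr].
  exact: (xr (0, k)).
by apply: bigmax_le => // -[i k] _; rewrite [i]ord1; exact: xr.
Qed.

Lemma rV_coord_le_norm (R : realType) (d : nat) (x : 'rV[R]_d) (k : 'I_d) :
  `|x 0 k| <= `|x|.
Proof. exact: (rV_normP _ _ x _ (normr_ge0 x)).1. Qed.

Lemma sgn_sqr (R : realType) (s : bool) : sgn s * sgn s = 1 :> R.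
Proof. by rewrite /sgn -expr2 sqrr_sign. Qed.

Lemma normr_sgn (R : realType) (s : bool) : `|sgn s : R| = 1.
Proof. exact: normr_sign. Qed.

Lemma sgn_coord_le_norm (R : realType) (d : nat) (s : bool) (x : 'rV[R]_d)
    (i : 'I_d) : sgn s * x 0 i <= `|x|.
Proof.
apply: le_trans (ler_norm _) _.
by rewrite normrM normr_sgn mul1r rV_coord_le_norm.
Qed.

Lemma sgn_coord_eq_norm (R : realType) (d : nat) (s : bool) (x : 'rV[R]_d)
    (i : 'I_d) :
  (forall k, `|x 0 k| <= sgn s * x 0 i) -> sgn s * x 0 i = `|x|.
Proof.
move=> xi; apply/le_anti; rewrite sgn_coord_le_norm /=.
by apply/rV_normP => //; exact: le_trans (normr_ge0 _) (xi i).
Qed.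

(** On the facet the signed [i]-th coordinate is 1 and dominates all others, and nonnegative
    combinations preserve this dominance. Conversely, a nonzero [x] is [|x|] times a point of the
    facet. *)
Lemma cone_facetP (R : realType) (d : nat) (s : bool) (i : 'I_d)
    (x : 'rV[R]_d) :
  cone (facet s i) x <-> sgn s * x 0 i = `|x|.
Proof.
split=> [[n [c [p [c0 Fp ->]]]]|xi].
  apply: sgn_coord_eq_norm => k; rewrite !summxE mulr_sumr.
  apply: le_trans (ler_norm_sum _ _ _) _; apply: ler_sum => l _.
  have [cp pli] := Fp l; rewrite !mxE pli mulrCA sgn_sqr mulr1.
  by rewrite normrM (ger0_norm (c0 l)) ler_piMr // ler_norml cp.
have [->|x0] := eqVneq x 0.
  (* The origin cannot be normalised; it is the empty combination. *)
  exists 0%N, (fun=> 0), (fun=> 0).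
  by split=> [//|[]//|]; rewrite big_ord0.
have nx0 : 0 < `|x| by rewrite normr_gt0.
exists 1%N, (fun=> `|x|), (fun=> `|x|^-1 *: x); split=> [//|_|].
  split=> [k|]; rewrite !mxE.
    rewrite -ler_norml normrM normfV normr_id mulrC ler_pdivrMr // mul1r.
    exact: rV_coord_le_norm.
  by rewrite -[x 0 i]mul1r -(sgn_sqr _ s) -mulrA xi mulrCA mulVf ?mulr1 ?gt_eqF.
by rewrite big_ord1 scalerA divff ?scale1r ?gt_eqF.
Qed.

(** The number [r] is the common value of [|y|] and [|y - x|]; sharing it between the two cone
    conditions encodes that [y] lies on the bisector. *)
Lemma bisection_cone_facetP (R : realType) (d : nat) (s1 s2 : bool)
    (i j : 'I_d) (x : 'rV[R]_d) :
  bisection_cone (facet s1 i) (facet s2 j) x <->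
  exists (r : R) (y : 'rV[R]_d),
    [/\ forall k, `|y 0 k| <= r, forall k, `|y 0 k - x 0 k| <= r,
        sgn s1 * y 0 i = r & sgn s2 * (y 0 j - x 0 j) = r].
Proof.
split=> [[y [[/= yx [u Fu yu] [v Gv yv]]]]|[r [y [yr yxr yi yxj]]]].
  move: yu yv yx; rewrite /bis /= addr0 subr0 => <- {y} vu uE.
  exists `|u|, u; have vE : v = u - x by rewrite -vu addrK.
  split=> [k|k||]; first exact: rV_coord_le_norm.
  - by have := rV_coord_le_norm _ _ (u - x) k; rewrite -uE !mxE.
  - exact/cone_facetP.
  - by move/cone_facetP: Gv; rewrite vE -uE !mxE.
have coordB k : (y - x) 0 k = y 0 k - x 0 k by rewrite !mxE.
have yE : sgn s1 * y 0 i = `|y|.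
  by apply: sgn_coord_eq_norm => k; rewrite yi.
have yxE : sgn s2 * (y - x) 0 j = `|y - x|.
  by apply: sgn_coord_eq_norm => k; rewrite !coordB yxj.
exists y; split; first split.
- by rewrite /bis /= subr0 -yE -yxE coordB yi yxj.
- by exists y; rewrite ?addr0 //; exact/cone_facetP.
- by exists (y - x); rewrite ?subrK //; exact/cone_facetP.
Qed.

Lemma dilate_halfspaceP (R : realType) (d : nat) (s : bool) (i : 'I_d)
    (x : 'rV[R]_d) :
  dilate (sgn s) (halfspace i) x <-> 0 <= sgn s * x 0 i.
Proof.
split=> [[y y0 <-]|x0]; first by rewrite mxE mulrA sgn_sqr mul1r.
exists (sgn s *: x); first by rewrite /halfspace /= mxE.
by rewrite scalerA sgn_sqr scale1r.
Qed.

Lemma sgnN (R : realType) (s : bool) : - sgn s = sgn (~~ s) :> R.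
Proof. by rewrite /sgn signrN. Qed.

Lemma bisection_cone_facet_neq (R : realType) (d : nat) (s1 s2 : bool)
    (i j : 'I_d) : i != j ->
  bisection_cone (facet s1 i) (facet s2 j) =
  dilate (sgn s1) (halfspace i) `&` dilate (- sgn s2) (halfspace j)
  :> set 'rV[R]_d.
Proof.
(* With [- sgn s2] written as a sign, [dilate_halfspaceP] covers both halfspaces. *)
move=> ij; rewrite sgnN; apply/seteqP; split=> x.
  move=> /bisection_cone_facetP[r [y [yr yxr yi yxj]]].
  (* Only two bounds are needed: [y_i - x_i] at most [r] in size gives [s1 * x_i >= 0], and [y_j] at
     most [r] in size gives [s2 * x_j <= 0]. *)
  move: (yxr i) (yr j) yi yxj; rewrite !ler_norml => /andP[? ?] /andP[? ?].
  by split; apply/dilate_halfspaceP; move: s1 s2 yi yxj => [] [];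
    rewrite /sgn /= !(expr0, expr1); lra.
move=> [/dilate_halfspaceP xi /dilate_halfspaceP xj].
apply/bisection_cone_facetP; exists `|x|.
exists (\row_k if k == i then sgn s1 * `|x| else
               if k == j then x 0 j + sgn s2 * `|x| else x 0 k).
have xle k := rV_coord_le_norm _ _ x k.
have bound k : - `|x| <= x 0 k <= `|x| by rewrite -ler_norml.
have /andP[? ?] := bound i; have /andP[? ?] := bound j.
have x0 := normr_ge0 x.
split=> [k|k||]; rewrite !mxE ?eqxx.
- case: ifP => _; first by rewrite normrM normr_sgn mul1r normr_id.
  case: ifP => _ //; rewrite ler_norml.
  (* Since [s2 * x_j] lies in [[-|x|, 0]], adding [|x|] lands in [[0, |x|]]. *)
  by move: s2 xj => []; rewrite /sgn /= !(expr0, expr1) => ?;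
    apply/andP; split; lra.
- case: ifP => [/eqP->|_].
    rewrite ler_norml.
    (* Since [s1 * x_i] lies in [[0, |x|]], so does [|x| - s1 * x_i]. *)
    by move: s1 xi => []; rewrite /sgn /= !(expr0, expr1) => ?;
      apply/andP; split; lra.
  case: ifP => [/eqP->|_]; last by rewrite subrr normr0.
  by rewrite addrAC subrr add0r normrM normr_sgn mul1r normr_id.
- by rewrite mulrA sgn_sqr mul1r.
- by rewrite eq_sym (negPf ij) addrAC subrr add0r mulrA sgn_sqr mul1r.
Qed.

(** Equal signed coordinates of [y] and [y - x] force [x_i = 0]; conversely, one moved coordinate
    then serves both facets. *)
Lemma bisection_cone_facet_same (R : realType) (d : nat) (s : bool)
    (i : 'I_d) :
  bisection_cone (facet s i) (facet s i) = [set a : 'rV[R]_d | a 0 i = 0].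
Proof.
apply/seteqP; split=> x /=.
  move=> /bisection_cone_facetP[r [y [_ _ yi yxi]]].
  by move: s yi yxi => []; rewrite /sgn /= !(expr0, expr1); lra.
move=> xi; apply/bisection_cone_facetP; exists `|x|.
exists (\row_k if k == i then sgn s * `|x| else x 0 k).
have sE : `|sgn s * `|x| | = `|x| by rewrite normrM normr_sgn mul1r normr_id.
split=> [k|k||]; rewrite !mxE ?eqxx.
- by case: ifP => _; rewrite ?sE // rV_coord_le_norm.
- case: ifP => [/eqP->|_]; first by rewrite xi subr0 sE.
  by rewrite subrr normr0.
- by rewrite mulrA sgn_sqr mul1r.
- by rewrite xi subr0 mulrA sgn_sqr mul1r.
Qed.

(** Adding the two facet equations gives [s * x_i = 2r], while the triangle inequality bounds every
    [|x_k|] by [2r]. Conversely, the midpoint of 0 and [x] works. *)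
Lemma bisection_cone_facet_opp (R : realType) (d : nat) (s : bool)
    (i : 'I_d) :
  bisection_cone (facet s i) (facet (~~ s) i) =
  cone (facet s i) :> set 'rV[R]_d.
Proof.
apply/seteqP; split=> x.
  move=> /bisection_cone_facetP[r [y [yr yxr yi yxi]]].
  apply/cone_facetP/sgn_coord_eq_norm => k.
  have -> : sgn s * x 0 i = r + r.
    by rewrite -{1}yi -yxi -sgnN; lra.
  by rewrite -[x 0 k](subKr (y 0 k)) (le_trans (ler_normB _ _)) // lerD.
move=> /cone_facetP xi; apply/bisection_cone_facetP.
exists (`|x| / 2), (2^-1 *: x).
have half k : `|2^-1 * x 0 k| <= `|x| / 2.
  by rewrite normrM ger0_norm ?invr_ge0 // mulrC ler_pM2r ?invr_gt0 //
    rV_coord_le_norm.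
split=> [k|k||]; rewrite !mxE //; rewrite -?sgnN -?xi; try lra.
rewrite xi; have -> : 2^-1 * x 0 k - x 0 k = - (2^-1 * x 0 k) by lra.
by rewrite normrN.
Qed.

Theorem proposition5p1 (R : realType) (d : nat) (s1 s2 : bool) :
  (forall i j : 'I_d, i != j ->
    bisection_cone (facet s1 i) (facet s2 j) =
    dilate (sgn s1) (halfspace i) `&` dilate (- sgn s2) (halfspace j)
    :> set 'rV[R]_d) /\
  (forall i : 'I_d,
    bisection_cone (facet s1 i) (facet s2 i) =
    (if s1 == s2 then [set a : 'rV[R]_d | a 0 i = 0] else cone (facet s1 i))
    :> set 'rV[R]_d).
Proof.
split=> [i j|i]; first exact: bisection_cone_facet_neq.
have [<-|] := eqVneq s1 s2; first exact: bisection_cone_facet_same.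
rewrite eq_sym => /negPf s21; have -> : s2 = ~~ s1 by move: s1 s2 s21 => [] [].
exact: bisection_cone_facet_opp.
Qed.
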